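(* Consider an MTDC network with $n$ buses described by $$C_i \dot V_i = -\sum_{j\in\mathcal N_i}\frac{1}{R_{ij}}(V_i-V_j) + I_i^{\text{inj}} + u_i,\qquad i=1,\dots,n,$$ where the control input is given by the voltage droop controller $u_i = K_i^P(V_i^{\text{nom}}-V_i)$, $i=1,\dots,n$, and the injected currents $I_i^{\text{inj}}$ are constant. Let $K^P=\operatorname{diag}(K^P_1,\dots,K^P_n)$. Then: (1) The equilibrium of the closed-loop system is stable for any $K^P>0$ (i.e. all $K_i^P>0$), in the sense that the voltages $V(t)$ converge to some constant value as $t\to\infty$. (2) In general, Objective 1 (defined in the context) is not satisfied; that is, there exist such networks, injected currents, nominal voltages, cost weights and gains $K^P>0$ for which the closed-loop system does not satisfy Objective 1. (3) The controlled injected currents satisfy $\lim_{t\to\infty}\sum_{i=1}^n \big(u_i(t)+I_i^{\text{inj}}\big)=0$.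
   Context: MTDC network: a connected undirected graph with vertex set $\mathcal V=\{1,\dots,n\}$ (buses) and edges (HVDC lines); $\mathcal N_i$ is the set of neighbours of $i$; each line $\{i,j\}$ has resistance $R_{ij}=R_{ji}>0$; $C_i>0$ is the capacitance of bus $i$; $V_i(t)\in\mathbb R$ is the voltage of bus $i$; $I_i^{\text{inj}}\in\mathbb R$ is a constant injected current; $u_i$ is the controlled injected current; $V_i^{\text{nom}}\in\mathbb R$ is the constant nominal voltage. $\mathcal L_R$ is the weighted Laplacian of the graph with edge weights $1/R_{ij}$. Vectors $V,u,I^{\text{inj}},V^{\text{nom}}\in\mathbb R^n$ collect the components. Objective 1: let $f_i>0$ and $g_i\ge 0$, $i=1,\dots,n$, be given constants. Consider the problem of minimizing $\sum_{i=1}^n \frac12 f_i u_i^2$ over $(u,V)\in\mathbb R^n\times\mathbb R^n$ subject to $\mathcal L_R V = I^{\text{inj}}+u$. Let $u^*$ be the (unique) optimal $u$ and $V^*$ the set of all optimal $V$ (i.e. all $V$ with $\mathcal L_R V=I^{\text{inj}}+u^*$). Objective 1 is satisfied if $\lim_{t\to\infty}u(t)=u^*$ and the asymptotic voltages minimize $\sum_{i=1}^n \frac12 g_i(V_i^{\text{nom}}-V_i)^2$ over $V\in V^*$. *)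

(* Defs.v *)
From HB Require Import structures.
From mathcomp Require Import all_boot all_order all_algebra.
From mathcomp Require Import all_classical all_reals all_analysis.
Set Implicit Arguments.
Unset Strict Implicit.
Unset Printing Implicit Defensive.
Import Order.TTheory GRing.Theory Num.Theory.
Import numFieldNormedType.Exports.
Local Open Scope classical_set_scope.
Local Open Scope ring_scope.

(* [res i j] is only meaningful when [line i j] holds. *)
Record mtdc (R : realType) (n : nat) := Mtdc {
  line : rel 'I_n;
  res : 'I_n -> 'I_n -> R;
  cap : 'I_n -> R;
  bus_nonempty : (0 < n)%N;
  line_sym : symmetric line;
  line_irr : irreflexive line;
  line_connected : forall i j, connect line i j;
  res_sym : forall i j, line i j -> res i j = res j i;
  res_gt0 : forall i j, line i j -> 0 < res i j;
  cap_gt0 : forall i, 0 < cap i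
}.

Section Mtdc.
Context (R : realType) (n : nat).
Implicit Types (N : mtdc R n) (v u Iinj Vnom K : 'cV[R]_n) (f g : 'I_n -> R).

Definition laplacian N : 'M[R]_n :=
  \matrix_(i, j) if i == j then \sum_(k | line N i k) (res N i k)^-1
                 else if line N i j then - (res N i j)^-1 else 0.

Definition net_current N Iinj u v (i : 'I_n) : R :=
  - (\sum_(j | line N i j) (res N i j)^-1 * (v i ord0 - v j ord0))
  + Iinj i ord0 + u i ord0.

Definition droop K Vnom v : 'cV[R]_n :=
  \col_i (K i ord0 * (Vnom i ord0 - v i ord0)).

(* Solutions live on [0, +oo[: the equation is required for t > 0, together
   with continuity up to t = 0; the values of V at negative times are
   irrelevant. *)
Definition mtdc_solution N Iinj (u V : R -> 'cV[R]_n) : Prop :=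
  forall i : 'I_n,
    {within `[0, +oo[, continuous (fun s : R => V s i ord0)} /\
    forall t : R, 0 < t ->
      derivable (fun s : R => V s i ord0) t 1 /\
      cap N i * derive1 (fun s : R => V s i ord0) t
        = net_current N Iinj (u t) (V t) i.

Definition closed_loop N Iinj Vnom K (V : R -> 'cV[R]_n) : Prop :=
  mtdc_solution N Iinj (fun t => droop K Vnom (V t)) V.

Definition closed_loop_equilibrium N Iinj Vnom K v : Prop :=
  forall i : 'I_n, net_current N Iinj (droop K Vnom v) v i = 0.

Definition injection_cost f u : R := \sum_i 2^-1 * f i * u i ord0 ^+ 2.

Definition voltage_cost g Vnom v : R :=
  \sum_i 2^-1 * g i * (Vnom i ord0 - v i ord0) ^+ 2.

Definition feasible N Iinj u v : Prop := laplacian N *m v = Iinj + u.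

Definition optimal N Iinj f u v : Prop :=
  feasible N Iinj u v /\
  forall u' v', feasible N Iinj u' v' -> injection_cost f u <= injection_cost f u'.

(* [Vlim] is the asymptotic voltage vector; the set of optimal voltages is
   [set v | optimal N Iinj f ustar v]. *)
Definition objective1 N Iinj Vnom f g (u V : R -> 'cV[R]_n) : Prop :=
  exists ustar Vlim : 'cV[R]_n,
    [/\ u t @[t --> +oo] --> ustar,
        V t @[t --> +oo] --> Vlim,
        optimal N Iinj f ustar Vlim
      & forall v, optimal N Iinj f ustar v ->
          voltage_cost g Vnom Vlim <= voltage_cost g Vnom v].

End Mtdc.

(* Main.v *)
(* Green's identity for the Laplacian L gives x^T L x >= 0 and 1^T L = 0.  The
   first makes L + K^P invertible, hence a unique equilibrium, and shows that
   sum_i C_i (V_i - Veq_i)^2 decays exponentially along solutions; the second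
   gives the limit of the total current.  For Objective 1, two buses joined by a
   unit line with injections (1, -1), zero nominal voltage and unit gains have
   u* = 0, whereas the droop currents tend to (-1/3, 1/3). *)
Require Import Defs.
From HB Require Import structures.
From mathcomp Require Import all_boot all_order all_algebra.
From mathcomp Require Import all_classical all_reals all_analysis.
From mathcomp Require Import ring lra.
Import Order.TTheory GRing.Theory Num.Theory.
Import numFieldNormedType.Exports.
Local Open Scope classical_set_scope.
Local Open Scope ring_scope.

(** * Exponential decay and entrywise convergence *)

Section Decay.
Context (R : realType).

(** Gronwall argument: [F t * expR (c * t)] is nonincreasing, so [F] is squeezed between 0 and a
    multiple of [expR (- (c * t))]. *)
Lemma exp_decay_cvg0 (c : R) (F : R -> R) : 0 < c ->
  (forall t, 0 <= F t) ->
  (forall t : R, 0 < t -> derivable F t 1 /\ derive1 F t <= - c * F t) ->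
  F t @[t --> +oo] --> 0.
Proof.
move=> c0 F0 dF.
pose G t := F t * expR (c * t).
have dG (t : R) : 0 < t -> is_derive t 1 G
    (F t * (c * expR (c * t)) + expR (c * t) * derive1 F t).
  move=> t0; have [dFt _] := dF t t0.
  have isF : is_derive t 1 F (derive1 F t) by rewrite derive1E; exact: DeriveDef.
  apply: is_derive_eq; rewrite !scaler1 /GRing.scale /=; ring.
(* The base point is 1 because nothing is assumed about the regularity of [F] at 0. *)
have Gle (t : R) : 1 <= t -> G t <= G 1.
  move=> t1; apply: (@ler0_derive1_nincry _ G 1) => // [x|x|].
  - rewrite in_itv /= andbT => x1.
    by have [] := dG x (lt_trans ltr01 x1).
  - rewrite in_itv /= andbT => x1; have x0 := lt_trans ltr01 x1.
    have -> : derive1 G x = F x * (c * expR (c * x)) + expR (c * x) * derive1 F x.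
      by rewrite derive1E; exact: (@derive_val _ _ _ _ _ _ _ (dG x x0)).
    have [_ dFx] := dF x x0.
    have := ler_wpM2l (expR_ge0 (c * x)) dFx; lra.
  - apply: derivable_within_continuous => x; rewrite in_itv /= andbT => x1.
    by have [] := dG x (lt_le_trans ltr01 x1).
apply: (@squeeze_cvgr _ _ _ _ (fun=> 0) (fun t => G 1 * expR (- (c * t)))).
- near=> t; rewrite F0 /= -ler_pdivrMr ?expR_gt0// -expRN opprK.
  by apply: Gle; near: t; apply: nbhs_pinfty_ge; rewrite num_real.
- exact: cvg_cst.
- rewrite -(mulr0 (G 1)); apply: cvgMr.
  apply: (@cvg_comp _ _ _ (fun t => c * t) (fun x => expR (- x))); last exact: cvgr_expR.
  exact: gt0_cvgMry.
Unshelve. all: by end_near. Qed.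

Lemma cvg_mx_entrywise {T : Type} (Fl : set_system T) (FF : Filter Fl) m n
    (M : T -> 'M[R]_(m, n)) (A : 'M[R]_(m, n)) :
  (forall i j, M t i j @[t --> Fl] --> A i j) -> M t @[t --> Fl] --> A.
Proof.
move=> MA; apply/cvg_mx_entourageP => E EE.
apply: (@filter_forall _ _ (fun i (B : 'M[R]_(m, n)) =>
  forall j, (A i j, B i j) \in E)) => i.
apply: (@filter_forall _ _ (fun j (B : 'M[R]_(m, n)) =>
  (A i j, B i j) \in E)) => j.
apply: (@filterS _ _ _ (fun B : 'M[R]_(m, n) => E (A i j, B i j))).
  by move=> B; rewrite inE.
by have /cvg_entourageP/(_ E EE) := MA i j.
Qed.

End Decay.

(** * The weighted Laplacian and its quadratic form *)

Section Network.
Context (R : realType) (n : nat) (N : mtdc R n).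
Implicit Types (a v u Iinj Vnom K : 'cV[R]_n).

Lemma laplacian_mulE v i :
  (laplacian N *m v) i ord0 =
  \sum_(j | line N i j) (res N i j)^-1 * (v i ord0 - v j ord0).
Proof.
rewrite mxE (bigD1 i) //= mxE eqxx mulr_suml.
rewrite [X in _ + X](eq_bigr (fun j =>
    if line N i j then - (res N i j)^-1 * v j ord0 else 0)).
  (* By [line_irr], a neighbour of [i] differs from [i], so the diagonal and off-diagonal sums range
     over the same indices. *)
  rewrite -big_mkcondr /= [X in _ + X](eq_bigl (fun j => line N i j)); last first.
    by move=> j; have [->|] := eqVneq j i; rewrite ?line_irr.
  by rewrite -big_split; apply: eq_bigr => j _ /=; ring.
by move=> j ji; rewrite mxE eq_sym (negPf ji); case: ifP; rewrite ?mul0r.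
Qed.

(** Each line is counted once per orientation, whence the factor [2^-1]. *)
Lemma green_identity a v :
  \sum_i a i ord0 * (laplacian N *m v) i ord0 =
  2^-1 * \sum_i \sum_(j | line N i j)
    (res N i j)^-1 * ((a i ord0 - a j ord0) * (v i ord0 - v j ord0)).
Proof.
pose S (x : 'I_n -> 'I_n -> R) := \sum_i \sum_(j | line N i j)
  (res N i j)^-1 * (x i j * (v i ord0 - v j ord0)).
(* Reversing every line keeps its resistance and negates the voltage difference. *)
have swap : S (fun i _ => a i ord0) = - S (fun _ j => a j ord0).
  rewrite /S (exchange_big_dep predT) //= -sumrN; apply: eq_bigr => j _.
  rewrite -sumrN; apply: eq_big => [i|i ij]; first exact: line_sym.
  by rewrite (res_sym ij); ring.
have splitS : S (fun i j => a i ord0 - a j ord0)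
    = S (fun i _ => a i ord0) - S (fun _ j => a j ord0).
  rewrite /S -sumrB; apply: eq_bigr => i _.
  by rewrite -sumrB; apply: eq_bigr => j _; ring.
rewrite -/(S (fun i j => a i ord0 - a j ord0)) splitS.
have -> : \sum_i a i ord0 * (laplacian N *m v) i ord0 = S (fun i _ => a i ord0).
  apply: eq_bigr => i _; rewrite laplacian_mulE mulr_sumr.
  by apply: eq_bigr => j _; ring.
rewrite {2}swap; lra.
Qed.

Lemma laplacian_psd v : 0 <= \sum_i v i ord0 * (laplacian N *m v) i ord0.
Proof.
rewrite green_identity mulr_ge0 // sumr_ge0 // => i _; rewrite sumr_ge0 // => j ij.
by rewrite mulr_ge0 ?invr_ge0 ?(ltW (res_gt0 ij)) // -expr2 sqr_ge0.
Qed.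

Lemma sum_laplacian_mul v : \sum_i (laplacian N *m v) i ord0 = 0.
Proof.
have := green_identity (const_mx 1) v.
under eq_bigr do rewrite mxE mul1r.
move=> ->; rewrite big1 ?mulr0 // => i _; rewrite big1 // => j _.
by rewrite !mxE subrr mul0r mulr0.
Qed.

Lemma net_currentE Iinj u v i :
  net_current N Iinj u v i = (Iinj + u - laplacian N *m v) i ord0.
Proof. by rewrite /net_current -laplacian_mulE !mxE; ring. Qed.

(** * Equilibrium and convergence under droop control *)

Section Droop.
Context (Iinj Vnom K : 'cV[R]_n).
Hypothesis K_gt0 : forall i, 0 < K i ord0.

Let M := laplacian N + diag_mx K^T.

Lemma droop_mx_mulE v i :
  (M *m v) i ord0 = (laplacian N *m v) i ord0 + K i ord0 * v i ord0.
Proof. by rewrite mulmxDl mul_diag_mx !mxE. Qed.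

(** If [M] kills a vector, its quadratic form vanishes there; the Laplacian part is nonnegative and
    the gains are positive, so the vector is 0. *)
Lemma droop_mx_unit : M \in unitmx.
Proof.
(* [kermx] is a left kernel; transposing [M] turns its rows into vectors [x] with [M *m x^T = 0]. *)
rewrite -unitmx_tr -row_free_unit -kermx_eq0; apply/eqP/row_matrixP => k.
set x := row k _; rewrite row0.
have Mx0 : M *m x^T = 0.
  by apply: trmx_inj; rewrite trmx_mul trmxK trmx0; apply/sub_kermxP/row_sub.
have : \sum_i K i ord0 * (x^T i ord0) ^+ 2 <= 0.
  have /eqP : \sum_i x^T i ord0 * (M *m x^T) i ord0 = 0.
    by rewrite Mx0 big1 // => i _; rewrite [X in _ * X]mxE mulr0.
  under eq_bigr do rewrite droop_mx_mulE mulrDr.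
  rewrite big_split /= addrC addr_eq0 => /eqP sumE.
  rewrite -oppr_ge0; apply: le_trans (laplacian_psd x^T) _.
  rewrite -[leLHS]opprK -sumE lerN2; apply: ler_sum => i _.
  by rewrite expr2 mulrCA.
have term_ge0 i : true -> 0 <= K i ord0 * (x^T i ord0) ^+ 2.
  by rewrite mulr_ge0 ?sqr_ge0 ?(ltW (K_gt0 i)).
move=> sum_le0.
have /eqP : \sum_i K i ord0 * (x^T i ord0) ^+ 2 = 0.
  by apply/le_anti; rewrite sum_le0 sumr_ge0.
rewrite psumr_eq0 // => /allP sum0; apply/rowP => i.
have := sum0 i (mem_index_enum i); rewrite /= mulf_eq0 gt_eqF //= sqrf_eq0 mxE.
by move/eqP->; rewrite mxE.
Qed.

Definition droop_equilibrium : 'cV[R]_n :=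
  invmx M *m (Iinj + diag_mx K^T *m Vnom).

Lemma droop_equilibriumP v :
  closed_loop_equilibrium N Iinj Vnom K v <-> v = droop_equilibrium.
Proof.
have netE i : net_current N Iinj (droop K Vnom v) v i =
    (Iinj + diag_mx K^T *m Vnom - M *m v) i ord0.
  rewrite net_currentE mxE [RHS]mxE [(- (M *m v)) _ _]mxE droop_mx_mulE.
  by rewrite mul_diag_mx !mxE; ring.
split=> [eqv|vE i]; last first.
  by rewrite netE vE mulmxA mulmxV ?droop_mx_unit // mul1mx subrr mxE.
rewrite -[v]mul1mx -(mulVmx droop_mx_unit) -mulmxA; congr (_ *m _).
apply/esym/eqP; rewrite -subr_eq0; apply/eqP/colP => i.
by rewrite -netE eqv mxE.
Qed.

(** [F] is a Lyapunov function: weighting by [cap] lets the dynamics replace each [cap N i] times a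
    derivative by a net current, so its derivative is minus twice the quadratic form of [M] at the
    error [e]. *)
Lemma droop_mtdc_cvg (V : R -> 'cV[R]_n) (Veq : 'cV[R]_n) :
  closed_loop_equilibrium N Iinj Vnom K Veq ->
  closed_loop N Iinj Vnom K V -> V t @[t --> +oo] --> Veq.
Proof.
move=> eqV solV.
pose e t := V t - Veq.
pose F t := \sum_i cap N i * (V t i ord0 - Veq i ord0) ^+ 2.
(* A rate below every [K i ord0 / cap N i], obtained without taking a minimum. *)
pose c := (1 + \sum_i cap N i / K i ord0)^-1.
have ratio_ge0 i : 0 <= cap N i / K i ord0.
  by rewrite divr_ge0 // ltW // cap_gt0.
have c0 : 0 < c.
  by rewrite invr_gt0 ltr_pwDl // sumr_ge0.
have capc i : c * cap N i <= K i ord0.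
  rewrite mulrC ler_pdivrMr; last by rewrite -invr_gt0.
  rewrite mulrC -ler_pdivrMr // (bigD1 i) //= addrCA lerDl.
  by rewrite addr_ge0 // sumr_ge0.
(* Subtracting the equilibrium equation cancels [Iinj] and [Vnom]. *)
have netE t i : net_current N Iinj (droop K Vnom (V t)) (V t) i =
    - ((laplacian N *m e t) i ord0 + K i ord0 * e t i ord0).
  have := eqV i; rewrite !net_currentE /e mulmxBr !mxE; lra.
have F0 t : 0 <= F t.
  by rewrite sumr_ge0 // => i _; rewrite mulr_ge0 ?sqr_ge0 // ltW // cap_gt0.
have Fcvg : F t @[t --> +oo] --> 0.
  apply: (@exp_decay_cvg0 _ (2 * c)) => // [|t t0]; first by rewrite mulr_gt0.
  have isF : is_derive t 1 F (\sum_i 2 * (e t i ord0 *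
      net_current N Iinj (droop K Vnom (V t)) (V t) i)).
    have -> : F = \sum_i (fun t => cap N i * (V t i ord0 - Veq i ord0) ^+ 2).
      by apply/funext => s; rewrite fct_sumE.
    apply: is_derive_sum => i; have [_ /(_ t t0) [dV eqn]] := solV i.
    have isV : is_derive t 1 (fun s => V s i ord0) (derive1 (fun s => V s i ord0) t).
      by rewrite derive1E; exact: DeriveDef.
    apply: is_derive_eq; rewrite -eqn /e !mxE /GRing.scale /=; ring.
  split; first by have [] := isF.
  rewrite derive1E (@derive_val _ _ _ _ _ _ _ isF).
  rewrite -mulr_sumr mulNr -mulrA -mulrN ler_pM2l //.
  under eq_bigr do rewrite netE mulrN mulrDr.
  rewrite sumrN lerN2 big_split /=.
  (* The Laplacian term only helps the decay; the gain term alone dominates [c * F t]. *)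
  apply: (@le_trans _ _ (\sum_i e t i ord0 * (K i ord0 * e t i ord0))); last first.
    by rewrite lerDr laplacian_psd.
  rewrite /F mulr_sumr; apply: ler_sum => i _.
  have -> : e t i ord0 = V t i ord0 - Veq i ord0 by rewrite !mxE.
  by rewrite [leRHS]mulrCA [leLHS]mulrA -expr2 ler_wpM2r ?sqr_ge0 ?capc.
apply: cvg_mx_entrywise => i j; rewrite ord1.
apply/cvgrPdist_le => eps eps0.
(* One summand of [F] is at most [F], so [F t] below this threshold bounds the error at bus [i] by
   [eps]. *)
have eta0 : 0 < cap N i * eps ^+ 2 by rewrite mulr_gt0 ?cap_gt0 ?exprn_gt0.
move/cvgrPdist_le : Fcvg => /(_ _ eta0); apply: filterS => t.
rewrite sub0r normrN ger0_norm // => Ft.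
rewrite distrC -ler_sqr ?nnegrE ?(ltW eps0) // real_normK ?num_real //.
rewrite -(ler_pM2l (cap_gt0 N i)); apply: le_trans Ft.
rewrite /F (bigD1 i) //= lerDl sumr_ge0 // => k _.
by rewrite mulr_ge0 ?sqr_ge0 // ltW // cap_gt0.
Qed.

(** Supplies a solution, so that the counterexample is not vacuous. *)
Lemma constant_closed_loop v : closed_loop_equilibrium N Iinj Vnom K v ->
  closed_loop N Iinj Vnom K (fun=> v).
Proof.
move=> eqv i; split; first by move=> x; exact: cvg_cst.
by move=> t _; rewrite derive1_cst mulr0 eqv; split.
Qed.

(** At equilibrium the injected currents are the entries of the Laplacian applied to [v]. *)
Lemma sum_injected_eq0 v : closed_loop_equilibrium N Iinj Vnom K v ->
  \sum_i (droop K Vnom v i ord0 + Iinj i ord0) = 0.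
Proof.
move=> eqv; apply: etrans (sum_laplacian_mul v); apply: eq_bigr => i _.
have := eqv i; rewrite net_currentE !mxE; lra.
Qed.

Lemma sum_injected_cvg0 (V : R -> 'cV[R]_n) (Veq : 'cV[R]_n) :
  closed_loop_equilibrium N Iinj Vnom K Veq ->
  closed_loop N Iinj Vnom K V ->
  (\sum_i (droop K Vnom (V t) i ord0 + Iinj i ord0)) @[t --> +oo] --> (0 : R).
Proof.
move=> eqV solV; rewrite -[X in _ --> X](sum_injected_eq0 _ eqV).
apply: cvg_big => [|i _]; first exact: add_continuous.
apply: cvgD; last exact: cvg_cst.
rewrite mxE; under eq_fun do rewrite mxE.
apply: cvgMr; apply: cvgB; first exact: cvg_cst.
apply: (@cvg_comp _ _ _ V (fun B : 'cV[R]_n => B i ord0)); last exact: coord_continuous.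
exact: droop_mtdc_cvg eqV solV.
Qed.

End Droop.
End Network.

(** * A two-bus counterexample to Objective 1 *)

Section TwoBus.
Context (R : realType).

Let adj : rel 'I_2 := [rel i j | i != j].

Let adj_sym : symmetric adj.
Proof. by move=> i j; rewrite /adj /= eq_sym. Qed.

Let adj_irr : irreflexive adj.
Proof. by move=> i; rewrite /adj /= eqxx. Qed.

Let adj_connected i j : connect adj i j.
Proof. by have [->|ij] := eqVneq i j; [exact: connect0 | exact: connect1]. Qed.

Definition two_bus : mtdc R 2 :=
  @Mtdc R 2 adj (fun _ _ => 1) (fun=> 1) isT adj_sym adj_irr adj_connected
    (fun _ _ _ => erefl) (fun _ _ _ => ltr01) (fun=> ltr01).

(** An eigenvector of the two-bus Laplacian, with eigenvalue 2. *)
Definition alternating : 'cV[R]_2 := \col_i (-1) ^+ i.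

Lemma two_bus_laplacian s :
  laplacian two_bus *m (s *: alternating) = (2 * s) *: alternating.
Proof.
apply/colP => i; rewrite laplacian_mulE big_mkcond !big_ord_recl big_ord0 !mxE /=.
case: i => -[|[|//]] i2; rewrite /= ?expr0 ?expr1 ?invr1; lra.
Qed.

(** The 3 is the eigenvalue 2 plus the unit gain. *)
Lemma two_bus_equilibrium :
  closed_loop_equilibrium two_bus alternating 0 (const_mx 1) (3^-1 *: alternating).
Proof.
move=> i; rewrite net_currentE two_bus_laplacian !mxE; lra.
Qed.

Lemma two_bus_not_objective1 g (V : R -> 'cV[R]_2) :
  closed_loop two_bus alternating 0 (const_mx 1) V ->
  ~ objective1 two_bus alternating 0 (fun=> 1) g
      (fun t => droop (const_mx 1) 0 (V t)) V.
Proof.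
move=> solV [ustar [Vlim [_ Vcvg [feas opt] _]]].
have K1 (i : 'I_2) : 0 < (const_mx 1 : 'cV[R]_2) i ord0 by rewrite mxE.
have VlimE : Vlim = 3^-1 *: alternating.
  apply: (cvg_unique (@norm_hausdorff _ _) Vcvg).
  exact: droop_mtdc_cvg two_bus_equilibrium solV.
(* Feasibility of the limit voltage forces the coefficient [2 / 3 - 1]. *)
have ustarE : ustar = (- 3^-1) *: alternating.
  apply: (addrI alternating); rewrite -feas VlimE two_bus_laplacian.
  apply/colP => i; rewrite !mxE; lra.
(* The zero control is feasible and costs 0, whereas [ustar] costs [1 / 9]. *)
have feas0 : feasible two_bus alternating 0 (2^-1 *: alternating).
  by rewrite /feasible two_bus_laplacian mulfV ?scale1r ?addr0.
have := opt _ _ feas0.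
rewrite ustarE /injection_cost !big_ord_recl !big_ord0 !mxE /= ?expr0 ?expr1; lra.
Qed.

End TwoBus.

Theorem theorem4 (R : realType) :
  (forall (n : nat) (N : mtdc R n) (Iinj Vnom K : 'cV[R]_n),
     (forall i, 0 < K i ord0) ->
     exists Veq : 'cV[R]_n,
       (forall v, closed_loop_equilibrium N Iinj Vnom K v <-> v = Veq) /\
       (forall V : R -> 'cV[R]_n, closed_loop N Iinj Vnom K V ->
          V t @[t --> +oo] --> Veq)) /\
  (exists (n : nat) (N : mtdc R n) (Iinj Vnom K : 'cV[R]_n) (f g : 'I_n -> R),
     [/\ forall i, 0 < K i ord0,
         forall i, 0 < f i,
         forall i, 0 <= g i,
         exists V : R -> 'cV[R]_n, closed_loop N Iinj Vnom K V
       & forall V : R -> 'cV[R]_n, closed_loop N Iinj Vnom K V ->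
           ~ objective1 N Iinj Vnom f g
               (fun t => droop K Vnom (V t)) V]) /\
  (forall (n : nat) (N : mtdc R n) (Iinj Vnom K : 'cV[R]_n),
     (forall i, 0 < K i ord0) ->
     forall V : R -> 'cV[R]_n, closed_loop N Iinj Vnom K V ->
       (\sum_i (droop K Vnom (V t) i ord0 + Iinj i ord0)) @[t --> +oo]
         --> (0 : R)).
Proof.
split; last split.
- move=> n N Iinj Vnom K K0; exists (droop_equilibrium _ _ N Iinj Vnom K).
  split=> [v|V]; first exact: droop_equilibriumP.
  by apply: droop_mtdc_cvg => //; apply/droop_equilibriumP.
- exists 2, (two_bus R), (alternating R), 0, (const_mx 1), (fun=> 1), (fun=> 1).
  split=> [i|i|i||V]; rewrite ?mxE //; last exact: two_bus_not_objective1.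
  exists (fun=> 3^-1 *: alternating R).
  exact/constant_closed_loop/two_bus_equilibrium.
- move=> n N Iinj Vnom K K0 V.
  by apply: sum_injected_cvg0 => //; exact/droop_equilibriumP.
Qed.
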